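(* Let $x_*$ be a locally optimal solution of the problem \[ (\mathcal{P}) \quad \text{minimize } f_0(x) = g_0(x) - h_0(x) \quad \text{subject to } F(x) = G(x) - H(x) \preceq_K 0, \quad x \in Q, \] and let the mappings $G$ and $H$ be Fréchet differentiable at $x_*$. Suppose also that the following constraint qualification holds true: \[ 0 \in \operatorname{int}\Big\{ G(x) - H(x_* ) - D H(x_* )(x - x_* ) + K \Bigm| x \in Q \Big\} \] (if $K$ has nonempty interior, it is sufficient to suppose that there exists $x \in Q$ such that $G(x) - H(x_* ) - D H(x_* )(x - x_* ) \in - \operatorname{int} K$). Then for any $v \in \partial h_0(x_* )$ there exists a multiplier $\lambda_* \in K^*$ such that $\langle \lambda_*, F(x_* ) \rangle = 0$ and \[ v \in \partial g_0(x_* ) + D \big( \langle \lambda_*, F(\cdot) \rangle \big)(x_* ) + N_Q(x_* ). \] In particular, if both $g_0$ and $h_0$ are differentiable at $x_*$, then there exists $\lambda_* \in K^*$ such that $\langle \lambda_*, F(x_* ) \rangle = 0$ and $\langle D_x L(x_*, \lambda_* ), x - x_* \rangle \ge 0$ for all $x \in Q$, where $L(x, \lambda) = f_0(x) + \langle \lambda, F(x) \rangle$.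
   Context: $g_0, h_0 \colon \mathbb{R}^d \to \mathbb{R}$ are real-valued closed convex functions; $\partial$ denotes the subdifferential in the sense of convex analysis. $Y$ is a real Banach space with topological dual $Y^*$ and pairing $\langle y^*, y\rangle = y^*(y)$; $K \subset Y$ is a proper cone, meaning a closed convex cone with $K \cap (-K) = \{0\}$; $x \preceq_K y$ iff $y - x \in K$; $K^* = \{ y^* \in Y^* \mid \langle y^*, y \rangle \ge 0 \ \forall y \in K \}$. The maps $G, H \colon \mathbb{R}^d \to Y$ are $K$-convex: $G(\alpha x_1 + (1-\alpha)x_2) \preceq_K \alpha G(x_1) + (1-\alpha) G(x_2)$ for all $\alpha \in [0,1]$, $x_1, x_2 \in \mathbb{R}^d$, and similarly for $H$. $Q \subseteq \mathbb{R}^d$ is a closed convex set. $D$ denotes the Fréchet derivative (and $D_x$ the derivative in $x$). $\{\,\Phi(x) + K \mid x \in Q\}$ denotes the union over $x \in Q$ of the sets $\Phi(x)+K$. For a convex set $V$ and $x \in V$, $N_V(x) = \{ v \in \mathbb{R}^d \mid \langle v, z - x \rangle \le 0 \ \forall z \in V \}$. *)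

(* Defs.v *)
From mathcomp Require Import all_boot all_order all_algebra.
From mathcomp Require Import all_classical all_reals all_analysis.

Set Implicit Arguments.
Unset Strict Implicit.
Unset Printing Implicit Defensive.

Import Order.TTheory GRing.Theory Num.Theory.
Import numFieldNormedType.Exports.

Local Open Scope classical_set_scope.
Local Open Scope ring_scope.

(* R^d is 'rV[R]_d; the sup norm it carries has the Euclidean topology and the
   Euclidean notion of Frechet differentiability. *)
Definition dotrv (R : realType) (d : nat) (u v : 'rV[R]_d) : R :=
  \sum_(i < d) u 0 i * v 0 i.

(* The row vector with dotrv (gradient f x) h = 'd f x h when f is
   differentiable at x. *)
Definition gradient (R : realType) (d : nat) (f : 'rV[R]_d -> R)
    (x : 'rV[R]_d) : 'rV[R]_d :=
  \row_(i < d) 'd f x (delta_mx 0 i).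

(* A finite-valued convex function is proper, so it is closed iff it is lower
   semicontinuous, i.e. iff its epigraph is closed. *)
Definition closed_convex_function (R : realType) (d : nat)
    (f : 'rV[R]_d -> R) : Prop :=
  convex_function setT f /\ lower_semicontinuous (EFin \o f).

Definition subdifferential (R : realType) (d : nat) (f : 'rV[R]_d -> R)
    (x : 'rV[R]_d) : set 'rV[R]_d :=
  [set v | forall z, f x + dotrv v (z - x) <= f z].

Definition normal_cone (R : realType) (d : nat) (V : set 'rV[R]_d)
    (x : 'rV[R]_d) : set 'rV[R]_d :=
  [set v | forall z, V z -> dotrv v (z - x) <= 0].

Definition proper_cone (R : realType) (Y : normedModType R) (K : set Y) : Prop :=
  [/\ closed K, convex_set K,
      (forall (a : R) (y : Y), 0 <= a -> K y -> K (a *: y))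
    & K `&` [set - y | y in K] = [set 0]].

Definition cone_le (R : realType) (Y : normedModType R) (K : set Y)
    (x y : Y) : Prop := K (y - x).

Definition cone_convex (R : realType) (d : nat) (Y : normedModType R)
    (K : set Y) (G : 'rV[R]_d -> Y) : Prop :=
  forall (a : R) (x1 x2 : 'rV[R]_d), 0 <= a <= 1 ->
    cone_le K (G (a *: x1 + (1 - a) *: x2)) (a *: G x1 + (1 - a) *: G x2).

(* Elements of the topological dual are the continuous linear functionals. *)
Definition dual_cone (R : realType) (Y : normedModType R) (K : set Y) :
    set {linear Y -> R} :=
  [set l : {linear Y -> R} | continuous l /\ forall y, K y -> 0 <= l y].

Definition feasible_set (R : realType) (d : nat) (Y : normedModType R)
    (K : set Y) (Q : set 'rV[R]_d) (F : 'rV[R]_d -> Y) : set 'rV[R]_d :=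
  [set x | cone_le K (F x) 0 /\ Q x].

Definition locally_optimal (R : realType) (d : nat) (f : 'rV[R]_d -> R)
    (A : set 'rV[R]_d) (xs : 'rV[R]_d) : Prop :=
  A xs /\ \forall x \near xs, A x -> f xs <= f x.

(* The K-convex map obtained from G - H by linearizing H at xs. *)
Definition linearized (R : realType) (d : nat) (Y : normedModType R)
    (G H : 'rV[R]_d -> Y) (xs x : 'rV[R]_d) : Y :=
  G x - H xs - 'd H xs (x - xs).

Definition lagrangian (R : realType) (d : nat) (Y : normedModType R)
    (f : 'rV[R]_d -> R) (F : 'rV[R]_d -> Y) (x : 'rV[R]_d)
    (l : {linear Y -> R}) : R :=
  f x + l (F x).

(* Main.v *)
(* Since [H] is [K]-convex, it lies above its linearization at [xs], so every
   point [x] of [Q] with [Phi x := linearized G H xs x] in [- K] is feasible;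
   as [h0] lies above its affine minorant of slope [v], the point [xs] minimizes
   the convex function [phi := g0 - <v, .>] over such [x], locally and hence
   globally. The set of the triples [(y, z, t)] such that [Phi x <=_K y] and
   [phi (x + z) - phi xs <= t] for some [x] in [Q] is convex, and Hahn-Banach
   yields a linear functional on [Y * R^d] below [t] on it: its [Y] component is
   the opposite of the multiplier, and its [R^d] component is a subgradient of
   [phi] at [xs].
   The constraint qualification covers a neighborhood of [0] in [Y] by the
   closed sets of all [y] with [Phi x <=_K y] for some [x] in [Q] such that
   [|x| <= n] and [phi x <= n], so that one of them has an interior point by
   Baire; the multiplier is bounded on one side there, hence continuous. *)
Require Import Defs.
From HB Require Import structures.
From mathcomp Require Import all_boot all_order all_algebra.
From mathcomp Require Import all_classical all_reals all_analysis.
From mathcomp Require Import ring lra.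
Import Order.TTheory GRing.Theory Num.Theory.
Import numFieldNormedType.Exports.
Local Open Scope classical_set_scope.
Local Open Scope ring_scope.

Set Implicit Arguments.

(** * Bounds on infima and the Hahn-Banach theorem *)

Lemma le_infD (R : realType) (A B : set R) (c : R) :
  A !=set0 -> B !=set0 -> (forall a b, A a -> B b -> c <= a + b) ->
  c <= inf A + inf B.
Proof.
move=> A0 B0 AB; rewrite -lerBlDr; apply: lb_le_inf => // a Aa.
rewrite lerBlDr -lerBlDl; apply: lb_le_inf => // b Bb.
by rewrite lerBlDl; exact: AB.
Qed.

Lemma inf_scale_le (R : realType) (A B : set R) (a : R) :
  0 < a -> A !=set0 -> has_lbound B -> (forall x, A x -> B (a * x)) ->
  inf B <= a * inf A.
Proof.
move=> a0 A0 B0 AB; rewrite -ler_pdivrMl//; apply: lb_le_inf => // x Ax.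
by rewrite ler_pdivrMl//; apply: ge_inf => //; exact: AB.
Qed.

Section sublinear.
Context (R : realType) (V : lmodType R).
Implicit Type q : V -> R.

Definition sublinear q : Prop :=
  (forall y z, q (y + z) <= q y + q z) /\
  (forall a y, 0 < a -> q (a *: y) = a * q y).

Lemma sublinear0 q : sublinear q -> q 0 = 0.
Proof.
move=> [_ /(_ 2 0)]; rewrite scaler0 => /(_ ltac:(lra)); lra.
Qed.

Lemma sublinear_ge q y : sublinear q -> - q (- y) <= q y.
Proof.
move=> sq; have [+ _] := sq => /(_ y (- y)).
by rewrite subrr sublinear0//; lra.
Qed.

Lemma sublinear_le q : (forall y z, q (y + z) <= q y + q z) ->
  (forall a y, 0 < a -> q (a *: y) <= a * q y) -> sublinear q.
Proof.
move=> qD qZ; split=> // a y a0; apply/eqP; rewrite eq_le qZ//=.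
rewrite -ler_pdivlMl//; have := qZ a^-1 (a *: y).
by rewrite invr_gt0 scalerA mulVf ?gt_eqF// scale1r; exact.
Qed.

(** Two members of a chain are comparable, so the smaller one serves for both arguments in
    subadditivity. The bound [- q (- y)] keeps each infimum finite. *)
Lemma inf_chain_sublinear (A : set (V -> R)) q :
  A !=set0 -> (forall p, A p -> sublinear p /\ forall y, p y <= q y) ->
  (forall p r, A p -> A r ->
    (forall y, p y <= r y) \/ (forall y, r y <= p y)) ->
  let i y := inf [set p y | p in A] in
  sublinear i /\ forall p y, A p -> i y <= p y.
Proof.
move=> [p0 Ap0] Aq Atot i.
have lb y : has_lbound [set p y | p in A].
  exists (- q (- y)) => _ [p Ap <-]; have [sp pq] := Aq _ Ap.
  by apply: le_trans (sublinear_ge y sp); rewrite lerN2.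
have ne y : [set p y | p in A] !=set0 by exists (p0 y), p0.
have ip p y : A p -> i y <= p y by move=> Ap; apply: ge_inf => //; exists p.
split=> //; apply: sublinear_le => [y z|a y a0].
  apply: le_infD => // _ _ [p Ap <-] [r Ar <-].
  have [pr|rp] := Atot _ _ Ap Ar.
    apply: (le_trans (ip _ _ Ap)); have [[pD _] _] := Aq _ Ap.
    by apply: (le_trans (pD _ _)); rewrite lerD2l.
  apply: (le_trans (ip _ _ Ar)); have [[rD _] _] := Aq _ Ar.
  by apply: (le_trans (rD _ _)); rewrite lerD2r.
apply: inf_scale_le => // _ [p Ap <-]; exists p => //.
by have [[_ pZ] _] := Aq _ Ap; rewrite pZ.
Qed.

(* Minimality is tested against [y |-> inf_(t >= 0) (q (y + t h) - t q h)],
   which is again sublinear and below [q]. *)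
Lemma minimal_sublinear_additive q : sublinear q ->
  (forall p, sublinear p -> (forall y, p y <= q y) -> p = q) ->
  forall y h, q (y + h) = q y + q h.
Proof.
move=> sq qmin y h; have [qD qZ] := sq; apply/eqP; rewrite eq_le qD/=.
pose S y := [set q (y + t *: h) - t * q h | t in [set t : R | 0 <= t]].
have qZ0 t z : 0 <= t -> q (t *: z) = t * q z.
  rewrite le_eqVlt => /predU1P[<-|]; last exact: qZ.
  by rewrite scale0r mul0r sublinear0.
have lb z : has_lbound (S z).
  exists (- q (- z)) => _ [t /= t0 <-]; rewrite lerBrDr -qZ0//.
  have := qD (z + t *: h) (- z); rewrite addrAC subrr add0r; lra.
have S0 z : S z (q z) by exists 0 => //=; rewrite scale0r addr0 mul0r subr0.
have ne z : S z !=set0 by exists (q z).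
suff qE : (fun z => inf (S z)) = q.
  (* The competitor [t = 1] in the infimum turns [qE] into superadditivity. *)
  rewrite -lerBrDr -[in leLHS]qE; apply: ge_inf => //.
  by exists 1 => //=; rewrite scale1r mul1r.
apply: qmin => [|z]; last exact: ge_inf.
apply: sublinear_le => [u v|a u a0].
  apply: le_infD => // _ _ [s /= s0 <-] [t /= t0 <-].
  (* Parameters add up: [s + t] is a competitor for [u + v]. *)
  apply: (@le_trans _ _ (q (u + v + (s + t) *: h) - (s + t) * q h)).
    by apply: ge_inf => //; exists (s + t); rewrite //= addr_ge0.
  rewrite scalerDl addrACA; have := qD (u + s *: h) (v + t *: h); lra.
apply: inf_scale_le => // _ [t /= t0 <-].
exists (a * t); first by rewrite /= mulr_ge0// ltW.
by rewrite -scalerA -scalerDr qZ// mulrBr mulrA.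
Qed.

Lemma sublinear_additive_linear q : sublinear q ->
  (forall y h, q (y + h) = q y + q h) -> linear (q : V -> R^o).
Proof.
move=> sq qD a y z; rewrite qD; congr (_ + _); have [_ qZ] := sq.
have qN u : q (- u) = - q u.
  by apply/eqP; rewrite -addr_eq0 -qD addNr sublinear0.
have [a0|a0|->] := ltgtP a 0; last by rewrite !scale0r sublinear0.
- by rewrite -[a]opprK scaleNr qN qZ ?oppr_gt0// scaleNr.
- exact: qZ.
Qed.

(** Zorn's lemma provides a minimal sublinear functional below [q]; minimality makes it additive,
    hence linear. *)
Lemma hahn_banach q : sublinear q ->
  exists l : {linear V -> R}, forall y, l y <= q y.
Proof.
move=> sq; pose T := {p : V -> R | sublinear p /\ forall y, p y <= q y}.
(* The order is reversed: a maximal element for [le] is a minimal functional. *)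
pose le (p r : T) := `[< forall y, sval r y <= sval p y >].
have [p pmin] : exists p, forall r, le p r -> r = p.
  apply: Zorn.
  - by move=> p; apply/asboolP.
  - move=> p r s /asboolP pr /asboolP rs; apply/asboolP => y.
    exact: le_trans (pr y).
  - move=> [p hp] [r hr] /asboolP/= pr /asboolP/= rp; apply: eq_exist.
    by apply/funext => y; apply/eqP; rewrite eq_le pr rp.
  move=> A Atot; have [->|/set0P[p0 Ap0]] := eqVneq A set0.
    by exists (exist _ q (conj sq (fun y => lexx (q y))) : T).
  pose B := [set sval p | p in A].
  have B0 : B !=set0 by exists (sval p0), p0.
  have Bq p : B p -> sublinear p /\ forall y, p y <= q y.
    by move=> [[r hr] _ <-].
  have Btot p r : B p -> B r ->
      (forall y, p y <= r y) \/ (forall y, r y <= p y).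
    move=> [p' Ap <-] [r' Ar <-].
    by have [/asboolP|/asboolP] := Atot _ _ Ap Ar; [right|left].
  have [si iB] := inf_chain_sublinear _ B0 Bq Btot.
  have iq y : inf [set p y | p in B] <= q y.
    by apply: (le_trans (iB _ _ _)) (proj2 (svalP p0) y); exists p0.
  pose i y := inf [set p y | p in B].
  exists (exist _ i (conj si iq) : T) => s As; apply/asboolP => y /=.
  by apply: iB; exists s.
have [sp pq] := svalP p.
have pD : forall y h, sval p (y + h) = sval p y + sval p h.
  apply: minimal_sublinear_additive => // r sr rp.
  have rq y : r y <= q y by exact: le_trans (pq y).
  by have := pmin (exist _ r (conj sr rq) : T) ltac:(exact/asboolP) => <-.
pose pL := GRing.isLinear.Build _ _ _ _ (sval p : V -> R^o)
  (sublinear_additive_linear sp pD).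
pose l : {linear V -> R} := HB.pack (sval p : V -> R^o) pL.
by exists l.
Qed.

(* [hahn_banach] is applied to [q y = inf {t / s | s > 0, E (s y) t}], the gauge
   of the cone generated by [E]. *)
Lemma hahn_banach_convex (E : V -> R -> Prop) :
  (forall a y z s t, 0 <= a <= 1 -> E y s -> E z t ->
     E (a *: y + (1 - a) *: z) (a * s + (1 - a) * t)) ->
  (forall y, exists2 s, 0 < s & exists t, E (s *: y) t) ->
  (forall t, E 0 t -> 0 <= t) ->
  exists l : {linear V -> R}, forall y t, E y t -> l y <= t.
Proof.
move=> Econv Ecore E0.
pose S y := [set u | exists2 s : R, 0 < s & E (s *: y) (s * u)].
have ED y z u v : S y u -> S z v -> S (y + z) (u + v).
  move=> [s s0 Es] [t t0 Et].
  have st0 : 0 < s + t by lra.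
  have st1 : 0 <= t / (s + t) <= 1 by rewrite divr_ge0 ?ler_pdivrMr//=; lra.
  have stE : 1 - t / (s + t) = s / (s + t) by field; lra.
  (* The weight [t / (s + t)] brings both arguments to the common scale [s * t / (s + t)]. *)
  exists (t / (s + t) * s); first by rewrite mulr_gt0// divr_gt0.
  have := Econv _ _ _ _ _ st1 Es Et.
  rewrite stE !scalerA !mulrA.
  have -> : s / (s + t) * t = t / (s + t) * s by ring.
  by rewrite -scalerDr -mulrDr.
have ne y : S y !=set0.
  have [s s0 [t Et]] := Ecore y; exists (t / s); exists s => //.
  by rewrite mulrC divfK// gt_eqF.
(* Adding a fixed element of [S (- y)] to one of [S y] gives an element of [S 0], nonnegative by
   [E0]. *)
have lb y : has_lbound (S y).
  have [v Sv] := ne (- y); exists (- v) => u Su.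
  have [s s0] := ED _ _ _ _ Su Sv.
  rewrite subrr scaler0 => /E0; rewrite pmulr_rge0//; lra.
have [l lS] : exists l : {linear V -> R}, forall y, l y <= inf (S y).
  apply: hahn_banach; apply: sublinear_le => [y z|a y a0].
    by apply: le_infD => // u v; move=> Su Sv; apply: ge_inf => //; exact: ED.
  apply: inf_scale_le => // u [s s0 Es]; exists (s / a); first exact: divr_gt0.
  by rewrite scalerA mulrA !divfK ?gt_eqF.
exists l => y t Et; apply: (le_trans (lS y)); apply: ge_inf => //.
by exists 1; rewrite ?scale1r ?mul1r.
Qed.

End sublinear.

(** * Convexity with real weights, difference quotients, closed projections and Baire category *)

Lemma convex_setE (R : realType) (V : lmodType R) (A : set V) :
  convex_set A ->
  forall a x y, 0 <= a <= 1 -> A x -> A y -> A (a *: x + (1 - a) *: y).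
Proof.
move=> cA a x y /andP[a0 a1] /mem_set Ax /mem_set Ay.
by apply: set_mem; have /(_ (Itv01 a0 a1)) := cA _ _ _ Ax Ay.
Qed.

Lemma convex_functionTP (R : realType) (V : lmodType R) (f : V -> R) :
  convex_function setT f <->
  forall a x y, 0 <= a <= 1 ->
    f (a *: x + (1 - a) *: y) <= a * f x + (1 - a) * f y.
Proof.
split=> [cf a x y /andP[a0 a1]|cf t x y _ _].
  by have := cf (Itv01 a0 a1) x y (in_setT _) (in_setT _).
by apply: cf; rewrite ge0 le1.
Qed.

Lemma convex_cone_add (R : realType) (V : lmodType R) (K : set V) :
  convex_set K -> (forall a y, 0 <= a -> K y -> K (a *: y)) ->
  forall y z, K y -> K z -> K (y + z).
Proof.
move=> cK KZ y z Ky Kz.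
have half : 0 <= (2^-1 : R) <= 1 by lra.
have := KZ 2 _ ltac:(lra) (convex_setE cK _ _ _ half Ky Kz).
rewrite scalerDr !scalerA.
have -> : 2 * 2^-1 = 1 :> R by field.
have -> : 2 * (1 - 2^-1) = 1 :> R by field.
by rewrite !scale1r.
Qed.

(** The derivative along [h] is the limit of the quotients as [t] tends to [0] from the right, so it
    inherits every closed condition that they satisfy. *)
Lemma closed_diff (R : realType) (V W : normedModType R) (f : V -> W)
    (C : set W) (x h : V) :
  differentiable f x -> closed C ->
  (forall t : R, 0 < t <= 1 -> C (t^-1 *: (f (x + t *: h) - f x))) ->
  C ('d f x h).
Proof.
move=> df Ccl Ct; rewrite -deriveE//.
have fh : derivable f x h := diff_derivable df.
have fh0 : (fun t : R => t^-1 *: (f (x + t *: h) - f x)) @ 0^'+ -->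
    'D_h f x.
  have := cvg_dnbhs_at_right fh.
  apply: cvg_trans; apply: near_eq_cvg; near=> t.
  by rewrite /= [x + _]addrC.
apply: (closed_cvg C Ccl _ ('D_h f x) fh0); near=> t.
apply: Ct; apply/andP; split=> //.
near: t; apply: nbhs_right_le => //.
Unshelve. all: by end_near. Qed.

(** The projection of a closed relation along a compact set is closed: if no [x] in [A] is related
    to [y], compactness makes this hold uniformly near [y]. *)
Lemma closed_compact_fiber (X Y : topologicalType)
    (A : set X) (P : X -> Y -> Prop) :
  compact A ->
  (forall x y, ~ P x y -> \forall x' \near x & y' \near y, ~ P x' y') ->
  closed [set y | exists2 x, A x & P x y].
Proof.
move=> /compact_near_coveringP cA Pop y cly; apply: contrapT => /= nP.
have nPy : \near y, A `<=` [set x | ~ P x y].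
  apply: (cA _ _ (fun y x => ~ P x y)) => x Ax.
  by apply: Pop => Pxy; apply: nP; exists x.
by have [z [[x Ax Pxz] /(_ x Ax)]] := cly _ nPy.
Qed.

(** If no [C n] had an interior point, the complements would be open and dense, and a point common
    to all of them would lie in the covered open set. *)
Lemma baire_closed_cover (R : realType) (Y : completeNormedModType R)
    (C : (set Y)^nat) (y : Y) :
  (forall n, closed (C n)) -> nbhs y (\bigcup_n C n) ->
  exists n (z : Y), nbhs z (C n).
Proof.
move=> Ccl; rewrite nbhsE => -[U [Uop Uy] UC]; apply: contrapT => nC.
have dC n : open (~` C n) /\ dense (~` C n).
  split; first by rewrite openC.
  move=> O [z Oz] Oop; apply: contrapT => /set0P/negP/negPn/eqP OC.
  apply: nC; exists n, z; rewrite nbhsE; exists O => // w Ow.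
  by apply: contrapT => Cw; have : (O `&` ~` C n) w by []; rewrite OC.
have [z [Uz /= nCz]] := Baire dC (ex_intro _ y Uy) Uop.
by have [n _ Cnz] := UC z Uz; exact: nCz n I Cnz.
Qed.

(** Translation moves the bound to a ball around [0], and the symmetry of the ball makes it
    two-sided. *)
Lemma bounded_above_linear_continuous (R : realType) (Y : normedModType R)
    (l : {linear Y -> R}) (M : R) (z : Y) :
  (\forall y \near z, l y <= M) -> continuous l.
Proof.
move=> lM; apply: bounded_linear_continuous; apply/ex_bound.
exists (M - l z).
have lM0 : \forall y \near (0 : Y), l y <= M - l z.
  have := lM; rewrite (near_shift 0) subr0 => /=; apply: filterS => y /=.
  by rewrite linearD; lra.
have [e e0 le] := nbhs_norm0P.1 lM0.
apply/nbhs_norm0P; exists e => // y /= ye; rewrite ler_norml lerNl -linearN.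
by rewrite !le//= normrN.
Qed.

(** * The order of a proper cone and the closedness of epigraphs *)

Section convex_cone.
Context (R : realType) (Y : normedModType R) (K : set Y).
Hypothesis hK : proper_cone K.

Lemma cone0 : K 0.
Proof.
by have [_ _ _ /seteqP[_ /(_ 0 erefl)[]]] := hK.
Qed.

Lemma cone_scale (a : R) y : 0 <= a -> K y -> K (a *: y).
Proof. by have [_ _ + _] := hK; exact. Qed.

Lemma cone_add y z : K y -> K z -> K (y + z).
Proof. by have [_ cK KZ _] := hK; exact: convex_cone_add. Qed.

Lemma cone_le_trans x y z : cone_le K x y -> cone_le K y z -> cone_le K x z.
Proof.
by rewrite /cone_le => xy yz; rewrite -(subrKA y); exact: cone_add.
Qed.

Lemma cone_leD x y z w :
  cone_le K x y -> cone_le K z w -> cone_le K (x + z) (y + w).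
Proof. by rewrite /cone_le opprD addrACA; exact: cone_add. Qed.

Lemma cone_leZ (a : R) x y :
  0 <= a -> cone_le K x y -> cone_le K (a *: x) (a *: y).
Proof. by rewrite /cone_le -scalerBr; exact: cone_scale. Qed.

Lemma cone_le_conv (a : R) x y z w : 0 <= a <= 1 ->
  cone_le K x y -> cone_le K z w ->
  cone_le K (a *: x + (1 - a) *: z) (a *: y + (1 - a) *: w).
Proof.
move=> /andP[a0 a1] xy zw; apply: cone_leD; apply: cone_leZ => //.
by rewrite subr_ge0.
Qed.

(* With [b = xs + 2 (1 - t) / t (x - x')] close to [xs], the point [x] is
   [(1 - t) x' + t ((2 x - xs) / 2 + b / 2)], so that the bound on [Phi] near
   [xs] propagates to a bound of [Phi x] by [Phi x'] up to [O(t)]. *)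
Lemma cone_convex_epigraph_open d (Phi : 'rV[R]_d -> Y) (xs : 'rV[R]_d) M :
  cone_convex K Phi -> (\forall z \near xs, `|Phi z| <= M) ->
  forall x y, ~ K (y - Phi x) ->
    \forall x' \near x & y' \near y, ~ K (y' - Phi x').
Proof.
move=> cPhi PhiM x y nK.
have [Kcl _ _ _] := hK.
have [r r0 rK] : exists2 r, 0 < r & forall c, `|c - (y - Phi x)| < r -> ~ K c.
  have /nbhs_normP[r r0 rK] : nbhs (y - Phi x) (~` K).
    by apply: open_nbhs_nbhs; split => //; rewrite openC.
  by exists r => // c cr; apply: rK; rewrite /= distrC.
have M0 : 0 <= M by exact: le_trans (nbhs_singleton PhiM).
pose p := 2 *: x - xs.
pose B := 2^-1 * `|Phi p| + 2^-1 * M + `|y|.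
have B0 : 0 <= B by rewrite !addr_ge0 ?mulr_ge0 ?invr_ge0.
(* This value ensures [t < 1] and [t * B < r / 2], where [B] will bound the distance from [w] to
   [y]; the other half of [r] is left for the distance from [y'] to [y]. *)
pose t := r / (r + 2 * (B + 1)).
have D0 : 0 < r + 2 * (B + 1) by lra.
have t0 : 0 < t by rewrite divr_gt0.
have t1 : t < 1 by rewrite ltr_pdivrMr// mul1r; lra.
have tB : t * B < r / 2.
  by rewrite /t mulrAC ltr_pdivrMr//; nra.
pose c := 2 * (1 - t) / t.
have bxs : (fun x' => xs + c *: (x - x')) @ x --> xs.
  have := cvgD (cvg_cst xs)
    (cvgZl_tmp (k := c) (cvgB (cvg_cst x) (@cvg_id _ (nbhs x)))).
  by rewrite subrr scaler0 addr0; exact.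
have yr : \forall y' \near y, `|y - y'| < r / 2.
  by apply/nbhs_normP; exists (r / 2) => //=; rewrite divr_gt0.
near=> x' y' => Kxy.
pose b := xs + c *: (x - x').
have Mb : `|Phi b| <= M by rewrite /b; near: x'; exact: bxs _ PhiM.
have yy' : `|y - y'| < r / 2 by near: y'.
pose z := 2^-1 *: p + (1 - 2^-1) *: b.
pose w := 2^-1 *: Phi p + (1 - 2^-1) *: Phi b.
have zw : cone_le K (Phi z) w by apply: cPhi; lra.
have xE : x = (1 - t) *: x' + (1 - (1 - t)) *: z.
  by apply/rowP => i; rewrite !mxE /c; field; lra.
have ht : 0 <= 1 - t <= 1 by lra.
have : cone_le K (Phi x) ((1 - t) *: y' + (1 - (1 - t)) *: w).
  rewrite {1}xE; apply: (cone_le_trans (cPhi _ _ _ ht)).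
  exact: cone_le_conv.
(* It remains to see that the combination of [y'] and [w] is closer than [r] to [y]; its difference
   with [y] splits with the weights [1 - t] and [t]. *)
apply: rK; rewrite subKr opprB addrA subrK.
have -> : - y = - ((1 - t) *: y) - t *: y.
  by rewrite -opprD -scalerDl subrK scale1r.
rewrite addrACA -!scalerBr; apply: (le_lt_trans (ler_normD _ _)).
rewrite 2!normrZ (gtr0_norm t0) gtr0_norm ?subr_gt0// distrC.
have wB : `|w - y| <= B.
  apply: (le_trans (ler_normB _ _)); rewrite lerD2r.
  apply: (le_trans (ler_normD _ _)); rewrite !normrZ.
  have -> : 1 - 2^-1 = 2^-1 :> R by field.
  rewrite gtr0_norm ?invr_gt0//; nra.
have := ler_wpM2l (ltW t0) wB.
have : (1 - t) * `|y - y'| <= `|y - y'| by apply: ler_piMl => //; lra.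
lra.
Unshelve. all: by end_near. Qed.

End convex_cone.

(** * The pairing on ['rV[R]_d] *)

Section dotrv.
Context (R : realType) (d : nat).
Implicit Types u v w : 'rV[R]_d.

Lemma dotrvDl u v w : dotrv (u + v) w = dotrv u w + dotrv v w.
Proof.
by rewrite /dotrv -big_split; apply: eq_bigr => i _; rewrite mxE mulrDl.
Qed.

Lemma dotrvNl u v : dotrv (- u) v = - dotrv u v.
Proof. by rewrite /dotrv -sumrN; apply: eq_bigr => i _; rewrite mxE mulNr. Qed.

Lemma dotrvDr u v w : dotrv u (v + w) = dotrv u v + dotrv u w.
Proof.
by rewrite /dotrv -big_split; apply: eq_bigr => i _; rewrite mxE mulrDr.
Qed.

Lemma dotrvZr u a v : dotrv u (a *: v) = a * dotrv u v.
Proof.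
by rewrite /dotrv mulr_sumr; apply: eq_bigr => i _; rewrite mxE mulrCA.
Qed.

Lemma dotrvBr u v w : dotrv u (v - w) = dotrv u v - dotrv u w.
Proof. by rewrite dotrvDr -scaleN1r dotrvZr mulN1r. Qed.

Lemma linear_dotrv (l : {linear 'rV[R]_d -> R}) v :
  l v = dotrv (\row_i l (delta_mx 0 i)) v.
Proof.
rewrite {1}[v]row_sum_delta linear_sum; apply: eq_bigr => i _.
by rewrite linearZ mxE mulrC.
Qed.

Lemma continuous_dotrv u : continuous (dotrv u).
Proof.
apply: continuous_big => [|i _ v]; first exact: add_continuous.
exact: cvgM (cvg_cst _) (@coord_continuous _ _ _ _ _ v).
Qed.

Lemma closed_convex_subr_dotrv (f : 'rV[R]_d -> R) v :
  closed_convex_function f -> closed_convex_function (f \- dotrv v).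
Proof.
move=> [/convex_functionTP cf lf]; split=> [|x a].
  apply/convex_functionTP => a x y a01 /=; have := cf a x y a01.
  rewrite dotrvDr !dotrvZr; lra.
(* Half of the gap: near [x] the function [f] drops by less than [e] and the pairing grows by less
   than [e]. *)
rewrite /= lte_fin => ax; pose e := (f x - dotrv v x - a) / 2.
have e0 : 0 < e by rewrite /e; lra.
have [|V xV Vf] := lf x (f x - e); first by rewrite lte_fin; lra.
exists (V `&` [set y | dotrv v y < dotrv v x + e]).
  apply: filterI => //.
  have := continuous_dotrv (u := v) (x := x).
  move=> /cvgrPdist_lt/(_ _ e0); apply: filterS => y /=.
  by rewrite ltr_norml; lra.
move=> y [/Vf]; rewrite /= !lte_fin /e; lra.
Qed.

End dotrv.

(** * Multipliers for a convex program with a cone constraint *)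

Lemma nbhs0_scale (R : realType) (Y : normedModType R) (A : set Y) (y : Y) :
  nbhs 0 A -> exists2 s : R, 0 < s & A (s *: y).
Proof.
move=> /nbhs_norm0P[e /= e0 eA]; have y0 : 0 < `|y| + 1 by rewrite ltr_wpDl.
have s0 : 0 < e / (`|y| + 1) by rewrite divr_gt0.
exists (e / (`|y| + 1)) => //; apply: eA.
rewrite /= normrZ gtr0_norm// mulrAC ltr_pdivrMr// ltr_pM2l//; lra.
Qed.

Lemma linear_pair_split (R : realType) (V W : lmodType R)
    (m : {linear (V * W)%type -> R}) :
  exists (l : {linear V -> R}) (p : {linear W -> R}),
    forall y z, m (y, z) = l y + p z.
Proof.
have l_lin : linear (fun y => m (y, 0) : R^o).
  move=> a y z; rewrite -linearP; congr (m _).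
  by congr pair; rewrite /= scaler0 addr0.
pose l : {linear V -> R} :=
  HB.pack (fun y => m (y, 0) : R^o) (GRing.isLinear.Build _ _ _ _ _ l_lin).
have p_lin : linear (fun z => m (0, z) : R^o).
  move=> a y z; rewrite -linearP; congr (m _).
  by congr pair; rewrite /= scaler0 addr0.
pose p : {linear W -> R} :=
  HB.pack (fun z => m (0, z) : R^o) (GRing.isLinear.Build _ _ _ _ _ p_lin).
exists l, p => y z.
by rewrite /l /p /= -linearD; congr (m _); congr pair; rewrite ?addr0 ?add0r.
Qed.

Section multiplier.
Context (R : realType) (d : nat) (Y : completeNormedModType R).
Variables (K : set Y) (Q : set 'rV[R]_d) (phi : 'rV[R]_d -> R).
Variables (Phi : 'rV[R]_d -> Y) (xs : 'rV[R]_d) (M : R).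
Hypotheses (hK : proper_cone K) (cPhi : cone_convex K Phi).
Hypothesis PhiM : \forall z \near xs, `|Phi z| <= M.
Hypotheses (Qcl : closed Q) (Qcvx : convex_set Q) (Qxs : Q xs).
Hypothesis hphi : closed_convex_function phi.
Hypothesis xs_opt : forall x, Q x -> K (- Phi x) -> phi xs <= phi x.
Hypothesis CQ : nbhs 0 (\bigcup_(x in Q) [set Phi x + k | k in K]).

Lemma image_coneP y :
  (\bigcup_(x in Q) [set Phi x + k | k in K]) y <->
  exists2 x, Q x & K (y - Phi x).
Proof.
split=> [[x Qx [k Kk <-]]|[x Qx Kyx]]; exists x => //.
  by rewrite addrC addKr.
by exists (y - Phi x) => //; rewrite addrC subrK.
Qed.

(* The perturbation [z] of the argument of [phi] makes a single separation
   provide both the multiplier and a subgradient of [phi]. *)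
Lemma exists_perturbation_minorant :
  exists m : {linear (Y * 'rV[R]_d)%type -> R}, forall y z x,
    Q x -> K (y - Phi x) -> m (y, z) <= phi (x + z) - phi xs.
Proof.
have [/convex_functionTP cphi _] := hphi.
pose E (u : Y * 'rV[R]_d) t :=
  exists x, [/\ Q x, K (u.1 - Phi x) & phi (x + u.2) - phi xs <= t].
have [m mE] : exists m : {linear (Y * 'rV[R]_d)%type -> R},
    forall u t, E u t -> m u <= t.
  apply: hahn_banach_convex.
  - move=> a [y1 z1] [y2 z2] s t a01 [x1 [/= Q1 K1 s1]] [x2 [/= Q2 K2 s2]].
    exists (a *: x1 + (1 - a) *: x2); split => /=.
    + exact: convex_setE.
    + rewrite -/(cone_le K _ _).
      apply: (cone_le_trans hK _ _ _ (cPhi a x1 x2 a01)).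
      exact: cone_le_conv.
    + rewrite addrACA -!scalerDr; have := cphi a (x1 + z1) (x2 + z2) a01.
      case/andP: a01 => a0 a1; nra.
  (* The constraint qualification makes some positive multiple of [y] attainable, and [z] is
     unrestricted as [phi] is finite everywhere. *)
  - move=> [y z]; have [s s0 /image_coneP[x Qx Kx]] := nbhs0_scale _ _ y CQ.
    by exists s => //; exists (phi (x + s *: z) - phi xs), x.
  - move=> t [x [/= Qx]]; rewrite sub0r addr0 => /(xs_opt Qx); lra.
by exists m => y z x Qx Kx; apply: mE; exists x.
Qed.

(** Boundedness and closedness suffice in finite dimension; the condition on [phi] is closed by
    lower semicontinuity. *)
Lemma compact_sublevel (n : nat) :
  compact [set x | [/\ Q x, `|x| <= n%:R & phi x <= n%:R]].
Proof.
apply: bounded_closed_compact.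
  rewrite /= /bounded_near; near=> N => x [_ xn _]; apply: (le_trans xn).
  by near: N; exact: nbhs_pinfty_ge.
have [_ /lower_semicontinuousP lphi] := hphi.
rewrite [X in closed X](_ : _ =
  Q `&` [set x | `|x| <= n%:R] `&` ~` [set x | (n%:R%:E < (phi x)%:E)%E]).
  apply: closedI; last by apply: open_closedC; exact: lphi.
  apply: closedI => //.
  apply: (@closed_comp _ _ _ [set r : R | r <= n%:R]).
    by move=> x _; exact: norm_continuous.
  exact: closed_le.
apply/seteqP; split=> x /=; rewrite lte_fin.
  by move=> [Qx xn phixn]; split => //; apply/negP; rewrite -leNgt.
by move=> [[Qx xn] /negP]; rewrite -leNgt.
Unshelve. all: by end_near. Qed.

Lemma perturbation_minorant_continuous (l : {linear Y -> R}) :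
  (forall y x, Q x -> K (y - Phi x) -> l y <= phi x - phi xs) -> continuous l.
Proof.
move=> lphi.
pose C n := [set y | exists2 x,
  [/\ Q x, `|x| <= n%:R & phi x <= n%:R] & K (y - Phi x)].
(* [C n] is the projection along a compact set of the epigraph of [Phi], which is closed by the
   local bound [PhiM]. *)
have Ccl n : closed (C n).
  apply: (closed_compact_fiber _ (compact_sublevel n)) => x y.
  exact: cone_convex_epigraph_open PhiM _ _.
have Ccover : nbhs 0 (\bigcup_n C n).
  apply: filterS CQ => y /image_coneP[x Qx Kx].
  pose n := Num.bound (`|x| + `|phi x|).
  have xn : `|x| + `|phi x| < n%:R by apply: archi_boundP; rewrite addr_ge0.
  exists n => //; exists x => //; split => //.
    by have := normr_ge0 (phi x); lra.
  by have := normr_ge0 x; have := ler_norm (phi x); lra.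
have [n [z Cz]] := baire_closed_cover _ _ Ccl Ccover.
apply: (bounded_above_linear_continuous _ (n%:R - phi xs) z).
apply: filterS Cz => y [x [Qx _ xn] Kx].
by apply: le_trans (lphi _ _ Qx Kx) _; rewrite lerD2r.
Qed.

(** At [x = xs] the inequality is the subgradient inequality of [phi] up to the term [l (Phi xs)];
    at [z = xs - x] it bounds [l (Phi x)] below. *)
Lemma exists_multiplier : exists (l : {linear Y -> R}) (p : 'rV[R]_d),
  dual_cone K l /\
  forall x z, Q x -> dotrv p z <= phi (x + z) - phi xs + l (Phi x).
Proof.
have [m mE] := exists_perturbation_minorant.
have [l [p mlp]] := linear_pair_split m.
have K0 := cone0 hK.
exists (\- l : {linear Y -> R}), (\row_i p (delta_mx 0 i)); split; last first.
  move=> x z Qx; rewrite -linear_dotrv.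
  have := mE (Phi x) z x Qx; rewrite subrr mlp => /(_ K0) /=; lra.
split.
  have lc : continuous l.
    apply: perturbation_minorant_continuous => y x Qx Kx.
    by have := mE y 0 x Qx Kx; rewrite mlp linear0 !addr0.
  by move=> y; apply: cvgN; exact: lc.
move=> k Kk /=; rewrite oppr_ge0 leNgt; apply/negP => lk.
(* The minorant must be nonpositive at [(Phi xs + s *: k, 0)]; this [s] makes [l (s *: k)] large
   enough to violate that. *)
pose s := (`|l (Phi xs)| + 1) / l k.
have s0 : 0 < s by rewrite divr_gt0// ltr_wpDl.
have := mE (Phi xs + s *: k) 0 xs Qxs.
rewrite [_ + s *: k]addrC addrK addr0 subrr.
move=> /(_ (cone_scale hK _ _ (ltW s0) Kk)).
have lsk : l (s *: k) = `|l (Phi xs)| + 1.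
  by rewrite linearZ; apply: divfK; rewrite gt_eqF.
rewrite mlp linear0 addr0 linearD lsk.
by have := lerNnormlW (lexx `|l (Phi xs)|); lra.
Qed.

End multiplier.

(** * Derivatives of convex maps and subgradients *)

Lemma diff_dotrv (R : realType) (d : nat) (f : 'rV[R]_d -> R) x h :
  'd f x h = dotrv (gradient f x) h.
Proof. exact: linear_dotrv. Qed.

Lemma diff_continuous_linear_comp (R : realType) (V W : normedModType R)
    (l : {linear W -> R}) (f : V -> W) (x h : V) :
  continuous l -> differentiable f x -> 'd (l \o f) x h = l ('d f x h).
Proof.
move=> lc df; rewrite diff_comp//; last exact: linear_differentiable.
by rewrite diff_lin.
Qed.

Section differentiable_convex.
Context (R : realType) (d : nat).

(** Convexity along the segment from [x] to [z] puts each difference quotient below [F z - F x], and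
    closedness of [K] passes this to the limit. *)
Lemma cone_convex_diff_le (Y : normedModType R) (K : set Y)
    (F : 'rV[R]_d -> Y) (x z : 'rV[R]_d) :
  proper_cone K -> cone_convex K F -> differentiable F x ->
  cone_le K ('d F x (z - x)) (F z - F x).
Proof.
move=> hK cF dF; have [Kcl _ _ _] := hK.
pose C := [set u | K (F z - F x - u)].
apply: (@closed_diff _ _ _ _ C _ _ dF) => [|t /andP[t0 t1]].
  apply: (@closed_comp _ _ (fun u => F z - F x - u) K) => // u _.
  exact: cvgB (cvg_cst _) (@cvg_id _ (nbhs u)).
have := cF t z x; rewrite (ltW t0) t1 => /(_ isT).
have -> : t *: z + (1 - t) *: x = x + t *: (z - x).
  by apply/rowP => i; rewrite !mxE; ring.
move=> /(cone_scale hK t^-1 _ (ltW _)).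
rewrite invr_gt0 => /(_ t0); congr K.
rewrite -[in RHS](scale1r (F z - F x)) -[X in X *: _ - _](mulVf (lt0r_neq0 t0)).
rewrite -scalerA -scalerBr; congr (_ *: _).
by rewrite scalerBl scale1r (scalerBr t (F z)) opprB [F x - t *: _]addrC !addrA.
Qed.

(** The subgradient inequality at [x + t *: h] bounds each difference quotient below by
    [dotrv p h]. *)
Lemma subgradient_le_diff (f : 'rV[R]_d -> R) x p h :
  differentiable f x -> subdifferential f x p -> dotrv p h <= 'd f x h.
Proof.
move=> df pf.
apply: (@closed_diff _ _ _ _ [set u | dotrv p h <= u] _ _ df) => [|t].
  exact: closed_ge.
move=> /andP[t0 _] /=; rewrite ler_pdivlMl// -dotrvZr.
by have := pf (x + t *: h); rewrite addrAC subrr add0r; lra.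
Qed.

Lemma subdifferential_gradient (f : 'rV[R]_d -> R) x :
  convex_function setT f -> differentiable f x ->
  subdifferential f x (gradient f x).
Proof.
move=> /convex_functionTP cf df z; rewrite -diff_dotrv -lerBrDl.
apply: (@closed_diff _ _ _ _ [set u | u <= f z - f x] _ _ df) => [|t].
  exact: closed_le.
move=> /andP[t0 t1] /=; rewrite ler_pdivrMl//.
have := cf t z x; rewrite (ltW t0) t1 => /(_ isT).
have -> : t *: z + (1 - t) *: x = x + t *: (z - x).
  by apply/rowP => i; rewrite !mxE; ring.
lra.
Qed.

End differentiable_convex.

(** * The problem with [H] linearized at [xs] *)

Section linearized.
Context (R : realType) (d : nat) (Y : normedModType R).
Variables (K : set Y) (G H : 'rV[R]_d -> Y) (xs : 'rV[R]_d).
Hypothesis hK : proper_cone K.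

Lemma linearized_xs : linearized G H xs xs = (G \- H) xs.
Proof. by rewrite /linearized subrr linear0 subr0. Qed.

(** The linearized map is [G] plus an affine map, for which the convexity inequality is an
    equality. *)
Lemma cone_convex_linearized :
  cone_convex K G -> cone_convex K (linearized G H xs).
Proof.
move=> cG a x1 x2 a01.
pose w x := - H xs - 'd H xs (x - xs).
have wE x : linearized G H xs x = G x + w x by rewrite /linearized -addrA.
have wP : w (a *: x1 + (1 - a) *: x2) = a *: w x1 + (1 - a) *: w x2.
  have -> : w (a *: x1 + (1 - a) *: x2) = - H xs
      - 'd H xs (a *: (x1 - xs) + (1 - a) *: (x2 - xs)).
    by rewrite /w; congr (_ - 'd H xs _); apply/rowP => i; rewrite !mxE; ring.
  rewrite linearD !linearZ /w !scalerBr addrACA -opprD -scalerDl.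
  by rewrite [a + _]addrC subrK scale1r !opprD.
clearbody w; rewrite !wE !scalerDr addrACA wP; apply: cone_leD => //.
  exact: cG.
by rewrite /cone_le subrr; exact: cone0.
Qed.

(** Continuity at [xs] gives the local bound on which the closedness of the epigraph rests. *)
Lemma linearized_bounded_near :
  differentiable G xs -> differentiable H xs ->
  \forall z \near xs, `|linearized G H xs z| <= `|linearized G H xs xs| + 1.
Proof.
move=> dG dH.
have Gxs : G x @[x --> xs] --> G xs := differentiable_continuous dG.
have dHxs : 'd H xs (x - xs) @[x --> xs] --> 'd H xs (xs - xs).
  have xx : (fun x => x - xs) x @[x --> xs] --> xs - xs.
    exact: cvgB (@cvg_id _ (nbhs xs)) (cvg_cst _).
  by apply: (continuous_cvg _ _ xx); exact: diff_continuous.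
have lin_cvg : linearized G H xs x @[x --> xs] --> linearized G H xs xs.
  exact: cvgB (cvgB Gxs (cvg_cst (H xs))) dHxs.
by apply: (cvgr_norm_le _ lin_cvg); rewrite ltrDl.
Qed.

Lemma le_linearized x :
  cone_convex K H -> differentiable H xs ->
  cone_le K ((G \- H) x) (linearized G H xs x).
Proof.
move=> cH dH; have := cone_convex_diff_le x hK cH dH.
rewrite /cone_le /linearized /= => Kx.
suff -> : G x - H xs - 'd H xs (x - xs) - (G x - H x) =
  H x - H xs - 'd H xs (x - xs) by [].
rewrite opprB addrC addrA; congr (_ - _).
exact: subrKA.
Qed.

Lemma linearized_optimal (Q : set 'rV[R]_d) (g0 h0 : 'rV[R]_d -> R) v x :
  convex_function setT g0 -> cone_convex K G -> cone_convex K H ->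
  convex_set Q -> differentiable H xs ->
  locally_optimal (g0 \- h0) (feasible_set K Q (G \- H)) xs ->
  subdifferential h0 xs v ->
  Q x -> K (- linearized G H xs x) ->
  (g0 \- dotrv v) xs <= (g0 \- dotrv v) x.
Proof.
move=> /convex_functionTP cg cG cH cQ dH [[Kxs Qxs] opt] vh Qx Kx /=.
(* Points on the segment towards [x] stay feasible, and those close to [xs] can be compared with it
   by local optimality. *)
pose c t := xs + t *: (x - xs).
have cE t : c t = t *: x + (1 - t) *: xs.
  by apply/rowP => i; rewrite !mxE; ring.
have c0 : c t @[t --> (0 : R)^'+] --> xs.
  apply: cvg_at_right_filter.
  have := cvgD (cvg_cst xs)
    (cvgZr_tmp (a := x - xs) (@cvg_id _ (nbhs (0 : R)))).
  by rewrite scale0r addr0; exact.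
have [t /andP[t0 t1] fle] : exists2 t : R, 0 < t < 1 &
    feasible_set K Q (G \- H) (c t) -> (g0 \- h0) xs <= (g0 \- h0) (c t).
  near (0 : R)^'+ => t; exists t.
    apply/andP; split=> //; near: t; exact: nbhs_right_lt.
  by near: t; exact: c0 _ opt.
have t01 : 0 <= t <= 1 by rewrite !ltW.
have feas : feasible_set K Q (G \- H) (c t).
  split; last by rewrite cE; exact: convex_setE.
  apply: (cone_le_trans hK _ _ _ (le_linearized _ cH dH)).
  rewrite cE.
  apply: (cone_le_trans hK _ _ _ (cone_convex_linearized cG _ _ _ t01)).
  have : cone_le K (linearized G H xs x) 0 by rewrite /cone_le sub0r.
  move=> Kx0; have := cone_le_conv hK _ _ _ _ _ t01 Kx0 Kxs.
  rewrite !scaler0 addr0.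
  by rewrite linearized_xs.
(* Local optimality at [c t], convexity of [g0] and the subgradient bound on [h0] add up to [t]
   times the claim. *)
have := fle feas; have := cg t x xs t01; have := vh (c t).
rewrite -cE /c addrAC subrr add0r dotrvZr dotrvBr /= => hx gx fx.
rewrite -(ler_pM2l t0); lra.
Unshelve. all: by end_near. Qed.

End linearized.

(** Translation by [- y] sends a neighborhood of [0] into [K]; a Slater point thus yields the
    constraint qualification. *)
Lemma interior_add_cone (R : realType) (Y : normedModType R) (K : set Y)
    (y : Y) : interior K (- y) -> nbhs 0 [set y + k | k in K].
Proof.
rewrite /interior /= => Ky.
have yy : (fun z => z - y) z @[z --> (0 : Y)] --> - y.
  have := cvgB (@cvg_id _ (nbhs (0 : Y))) (cvg_cst y).
  by rewrite sub0r; exact.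
have : \forall z \near (0 : Y), K (z - y) := yy _ Ky.
apply: filterS => z /= Kzy.
by exists (z - y) => //; rewrite addrC subrK.
Qed.

(** * Optimality conditions at [xs] *)

Section linearized_multiplier.
Context (R : realType) (d : nat) (Y : completeNormedModType R).
Variables (K : set Y) (Q : set 'rV[R]_d) (g0 h0 : 'rV[R]_d -> R).
Variables (G H : 'rV[R]_d -> Y) (xs : 'rV[R]_d).
Hypotheses (hg0 : closed_convex_function g0) (hK : proper_cone K).
Hypotheses (hG : cone_convex K G) (hH : cone_convex K H).
Hypotheses (Qclosed : closed Q) (Qconvex : convex_set Q).
Hypothesis hxs :
  locally_optimal (g0 \- h0) (feasible_set K Q (G \- H)) xs.
Hypotheses (dG : differentiable G xs) (dH : differentiable H xs).
Hypothesis CQ :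
  nbhs 0 (\bigcup_(x in Q) [set linearized G H xs x + k | k in K]).

Lemma exists_linearized_multiplier v : subdifferential h0 xs v ->
  exists (l : {linear Y -> R}) (p : 'rV[R]_d),
    [/\ dual_cone K l, l ((G \- H) xs) = 0, subdifferential g0 xs p &
      normal_cone Q xs (v - p - gradient (l \o (G \- H)) xs)].
Proof.
move=> vh; have [[Kxs Qxs] _] := hxs.
have Kxs' : K (- (G \- H) xs) by move: Kxs; rewrite /cone_le sub0r.
have [l [q [lK lq]]] := exists_multiplier _ hK
  (cone_convex_linearized H xs hK hG)
  (linearized_bounded_near dG dH) Qclosed Qconvex Qxs
  (closed_convex_subr_dotrv v hg0)
  (fun x => linearized_optimal hK x (proj1 hg0) hG hH Qconvex dH hxs vh) CQ.
have [lc l0] := lK.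
have lF : l ((G \- H) xs) = 0.
  (* The unperturbed inequality at [xs] gives one sign of [l ((G \- H) xs)], and membership in the
     dual cone the other. *)
  have := l0 _ Kxs'; have := lq xs 0 Qxs.
  rewrite linearized_xs linearN addr0 subrr add0r.
  by rewrite -[X in dotrv q X](scale0r 0) dotrvZr mul0r; lra.
(* [q] is a subgradient of [g0 \- dotrv v] at [xs], so adding [v] gives one of [g0]. *)
exists l, (q + v); split => // [z|x Qx].
  have := lq xs (z - xs) Qxs; rewrite linearized_xs lF subrKC /= !dotrvDl.
  by rewrite !dotrvBr; lra.
have lB u w : l (u - w) = l u - l w by exact: linearB.
have dGH : differentiable (G \- H) xs by exact: differentiableB.
rewrite !dotrvDl !dotrvNl dotrvDl -diff_dotrv diff_continuous_linear_comp//.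
have -> : 'd (G \- H) xs (x - xs) = 'd G xs (x - xs) - 'd H xs (x - xs).
  exact: (congr1 (@^~ (x - xs)) (diffB dG dH)).
suff : - dotrv q (x - xs) + l ('d H xs (x - xs)) <= l ('d G xs (x - xs)).
  have aux (a b c e : R) : - c + b <= a -> e - (c + e) - (a - b) <= 0 by lra.
  by rewrite lB; exact: aux.
set h := x - xs.
(* The term in [H] is already linear along [h], so only [G] needs a passage to the limit. *)
apply: (@closed_diff _ _ _ _
    [set u | - dotrv q h + l ('d H xs h) <= l u] _ _ dG) => [|t].
  apply: (@closed_comp _ _ l [set r | - dotrv q h + l ('d H xs h) <= r]).
    by move=> u _; exact: lc.
  exact: closed_ge.
move=> /andP[t0 t1] /=.
have Qt : Q (xs + t *: h).
  have -> : xs + t *: h = t *: x + (1 - t) *: xs.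
    by apply/rowP => i; rewrite !mxE; ring.
  by apply: convex_setE; rewrite // (ltW t0).
(* This perturbation brings the argument of the objective back to [xs], so that only the constraint
   term remains. *)
have := lq _ (- (t *: h)) Qt; rewrite addrK subrr add0r.
rewrite /linearized [xs + _ - xs]addrAC subrr add0r -scaleNr dotrvZr.
rewrite linearB linearZ.
have lGH : l (G xs) = l (H xs).
  by apply/eqP; rewrite -subr_eq0 -linearB; apply/eqP.
rewrite linearB /= -lGH.
have -> : l (t^-1 *: (G (xs + t *: h) - G xs)) =
  t^-1 * (l (G (xs + t *: h)) - l (G xs)) by rewrite linearZ linearB.
rewrite ler_pdivlMl//.
have -> : l (t *: 'd H xs h) = t * l ('d H xs h) by rewrite linearZ.
lra.
Qed.

End linearized_multiplier.

Unset Implicit Arguments.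

Theorem corollary6 (R : realType) (d : nat) (Y : completeNormedModType R)
  (K : set Y) (Q : set 'rV[R]_d) (g0 h0 : 'rV[R]_d -> R) (G H : 'rV[R]_d -> Y)
  (xs : 'rV[R]_d)
  (hg0 : closed_convex_function g0) (hh0 : closed_convex_function h0)
  (hK : proper_cone K)
  (hG : cone_convex K G) (hH : cone_convex K H)
  (Qclosed : closed Q) (Qconvex : convex_set Q)
  (hxs : locally_optimal (g0 \- h0) (feasible_set K Q (G \- H)) xs)
  (dG : differentiable G xs) (dH : differentiable H xs) :
  let CQ :=
    interior (\bigcup_(x in Q) [set linearized G H xs x + k | k in K]) 0 in
  (interior K !=set0 ->
   (exists2 x, Q x & [set - k | k in interior K] (linearized G H xs x)) -> CQ)
  /\
  (CQ ->
   (forall v, subdifferential h0 xs v ->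
      exists ls : {linear Y -> R},
        [/\ dual_cone K ls, ls ((G \- H) xs) = 0 &
            exists p n, [/\ subdifferential g0 xs p, normal_cone Q xs n &
              v = p + gradient (ls \o (G \- H)) xs + n]])
   /\
   (differentiable g0 xs -> differentiable h0 xs ->
      exists ls : {linear Y -> R},
        [/\ dual_cone K ls, ls ((G \- H) xs) = 0 &
            forall x, Q x ->
              0 <= 'd (fun z => lagrangian (g0 \- h0) (G \- H) z ls) xs
                      (x - xs)])).
Proof.
move=> CQset; split=> [_ [x Qx [k Kk kE]]|CQ].
  have : nbhs 0 [set linearized G H xs x + k | k in K].
    by apply: interior_add_cone; rewrite -kE opprK.
  by apply: filterS => y [c Kc <-]; exists x => //; exists c.
have mult v := exists_linearized_multiplier hg0 hK hG hH Qclosed Qconvex hxs dG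
  dH CQ (v := v).
split=> [v /mult[l [p [lK lF pg nQ]]]|dg dh].
  exists l; split=> //; exists p, (v - p - gradient (l \o (G \- H)) xs).
  by split=> //; rewrite -[v - p - _]addrA -opprD subrKC.
(* The first part is applied to the gradient of [h0], a subgradient by convexity. *)
have [l [p [lK lF pg nQ]]] :=
  mult _ (subdifferential_gradient (proj1 hh0) dh).
exists l; split=> // x Qx; have [lc _] := lK.
have dF : differentiable (l \o (G \- H)) xs.
  apply: differentiable_comp; first exact: differentiableB.
  exact: linear_differentiable.
have -> : 'd (fun z => lagrangian (g0 \- h0) (G \- H) z l) xs (x - xs) =
    'd g0 xs (x - xs) - 'd h0 xs (x - xs) + 'd (l \o (G \- H)) xs (x - xs).
  have dgh : differentiable (g0 \- h0) xs by exact: differentiableB.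
  apply: (etrans (congr1 (@^~ (x - xs)) (diffD dgh dF))); congr (_ + _).
  exact: (congr1 (@^~ (x - xs)) (diffB dg dh)).
(* The derivative of [g0] dominates the pairing with [p], so the normal cone inequality carries over
   to the Lagrangian. *)
have aux (a b c e : R) : e <= a -> b - e - c <= 0 -> 0 <= a - b + c by lra.
apply: (aux _ _ _ _ (subgradient_le_diff (x - xs) dg pg)).
by have := nQ x Qx; rewrite !dotrvDl !dotrvNl -!diff_dotrv.
Qed.
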